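(* Let $\mathbb{H}$ be a uniform $\mathcal{L}_{\mathbb{H}}$-layered semifield, let $\mathbb{D}$ be a uniform $\mathcal{L}_{\mathbb{D}}$-layered domain extending $\mathbb{H}$, and let $a\in\mathbb{D}$ be such that $s(a)\in\mathcal{L}_{\mathbb{H}}$. Let $\mathbb{H}[a]= \{ f(a) : f \in \mathbb{H}[x] \}$. Then $$\mathscr{U}_{\mathbb{D}}(\mathbb{H}[a]) = \mathbb{H}[a] = \mathcal{L}_{\mathbb{H}} \odot \mathcal{G}(\mathbb{H}[\nu(a)]).$$
   Context: A uniform $\mathcal{L}$-layered domain is a set of pairs $\mathbb{D} = \{ {}^{[l]}a : l \in \mathcal{L},\ a \in \mathcal{G}\}$, where $\mathcal{G}$ (the semiring of values, written $\mathcal{G}(\mathbb{D})$) is an ordered semiring whose addition is the maximum and which is a domain (i.e. multiplicatively cancellative), and $\mathcal{L}$ (the sorting semiring, written $\mathcal{L}_{\mathbb{D}}$) is a partially pre-ordered commutative semiring without zero, assumed additively cancellative. Multiplication is ${}^{[k]}a \cdot {}^{[l]}b = {}^{[kl]}ab$; addition is ${}^{[k]}a + {}^{[l]}b = {}^{[k]}a$ if $a>b$, ${}^{[l]}b$ if $a<b$, and ${}^{[k+l]}b$ if $a=b$. One also writes $\mathbb{D} = \mathcal{L}\odot\mathcal{G}$ and ${}^{[l]}a = l \odot a$. The sorting map is $s({}^{[l]}a)=l$ and the ghost (value) map is $\nu({}^{[l]}a)=a$; for a subset $E$ of a layered domain, $\mathcal{G}(E)=\nu(E)$. A uniform layered semifield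 is a uniform layered domain $\mathcal{L}\odot\mathcal{G}$ that is a semifield; equivalently, $\mathcal{L}$ and $\mathcal{G}$ are both semifields. If $\mathbb{D}$ extends $\mathbb{H}$ (as a layered domain) then $\mathcal{L}_{\mathbb{H}}\subseteq\mathcal{L}_{\mathbb{D}}$ and $\mathcal{G}(\mathbb{H})\subseteq\mathcal{G}(\mathbb{D})$. $\mathbb{H}[x]$ is the polynomial semiring over $\mathbb{H}$ (polynomials over a semiring without zero are finite nonempty formal sums of monomials). The element $1\odot\nu(a)$ of $\mathbb{D}$ is abbreviated $\nu(a)$, so $\mathbb{H}[\nu(a)]=\{f(1\odot\nu(a)): f\in\mathbb{H}[x]\}$. For $E\subset\mathbb{D}$, the uniform closure $\mathscr{U}_{\mathbb{D}}(E)$ is the minimal (with respect to inclusion) uniform layered domain $\mathbb{E}$ (i.e. of the form $\mathcal{L}'\odot\mathcal{G}'$ with $\mathcal{L}'\subseteq\mathcal{L}_{\mathbb{D}}$, $\mathcal{G}'\subseteq\mathcal{G}(\mathbb{D})$) with $E\subseteq\mathbb{E}\subseteq\mathbb{D}$, if it exists. *)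

(* Defs.v *)
From HB Require Import structures.
From mathcomp Require Import all_boot all_order.
From mathcomp Require Import classical_sets.

Set Implicit Arguments.
Unset Strict Implicit.
Unset Printing Implicit Defensive.

Import Order.TTheory.
Local Open Scope classical_set_scope.
Local Open Scope order_scope.
Local Open Scope ring_scope.
Local Open Scope group_scope.

(* Commutative semirings "without zero": no additive identity is part of the
   structure, so nmodType-based semirings do not apply. Addition is [+%R] of
   addSemigroupType (commutative, associative), multiplication and 1 are those
   of monoidType, written in group_scope. *)
HB.mixin Record isComZfSemiring R of Algebra.AddSemigroup R & Monoid R := {
  zfmulC : commutative ( *%g : R -> R -> R);
  zfmulDl : left_distributive ( *%g : R -> R -> R) +%R
}.
#[short(type="comZfSemiringType")]
HB.structure Definition ComZfSemiring :=
  {R of isComZfSemiring R & Algebra.AddSemigroup R & Monoid R}.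

HB.mixin Record isPreorderedSemiring (d : Order.disp_t) R
    of ComZfSemiring R & Order.Preorder d R := {
  zfle_add2l : forall z x y : R, (x <= y)%O -> (z + x <= z + y)%O;
  zfle_mul2l : forall z x y : R, (x <= y)%O -> (z * x <= z * y)%O
}.
#[short(type="preorderedSemiringType")]
HB.structure Definition PreorderedSemiring (d : Order.disp_t) :=
  {R of isPreorderedSemiring d R & ComZfSemiring R & Order.Preorder d R}.

HB.mixin Record isSortingSemiring (d : Order.disp_t) R
    of PreorderedSemiring d R := {
  zfaddI : right_injective (+%R : R -> R -> R)
}.
#[short(type="sortingSemiringType")]
HB.structure Definition SortingSemiring (d : Order.disp_t) :=
  {R of isSortingSemiring d R & PreorderedSemiring d R}.

(* Cancellation is required of every element: a value semiring has no zero
   either, since a zero would make all the elements [k]0 of a layered semifield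
   noninvertible. *)
HB.mixin Record isValueSemiring (d : Order.disp_t) R
    of PreorderedSemiring d R & Order.Total d R := {
  zfaddE : forall x y : R, x + y = Order.max x y;
  zfmulI : right_injective ( *%g : R -> R -> R)
}.
#[short(type="valueSemiringType")]
HB.structure Definition ValueSemiring (d : Order.disp_t) :=
  {R of isValueSemiring d R & PreorderedSemiring d R & Order.Total d R}.

Record layered (L G : Type) := Layered { sorting : L; nu : G }.
Notation "l ⊙ a" := (Layered l a) (at level 35, no associativity).

Section LayeredChoice.
Variables L G : choiceType.
Let to_pair (x : layered L G) := (sorting x, nu x).
Let of_pair (p : L * G) := p.1 ⊙ p.2.
Fact layered_pairK : cancel to_pair of_pair. Proof. by case. Qed.
HB.instance Definition _ := Choice.copy (layered L G) (can_type layered_pairK).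
End LayeredChoice.

Section LayeredDomain.
Context {dL dG : Order.disp_t}.
Variables (L : sortingSemiringType dL) (G : valueSemiringType dG).
Local Notation D := (layered L G).
Implicit Types x y z : D.

Definition layered_add x y : D :=
  if (nu y < nu x)%O then x
  else if (nu x < nu y)%O then y
  else (sorting x + sorting y) ⊙ nu y.

Definition layered_mul x y : D := (sorting x * sorting y) ⊙ (nu x * nu y).

Definition layered_one : D := 1 ⊙ 1.

Fact layered_addC : commutative layered_add.
Proof.
move=> [k a] [l b]; rewrite /layered_add /=.
by case: ltgtP => //= ->; rewrite Algebra.addrC.
Qed.

Fact layered_addA : associative layered_add.
Proof.
move=> [k a] [l b] [m c]; rewrite /layered_add /=.
have [bc|cb|ebc] := ltgtP b c; have [ab|ba|eab] := ltgtP a b; subst=> //=.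
- by rewrite (lt_trans ab bc) (lt_gtF (lt_trans ab bc)) bc (lt_gtF bc).
- by rewrite bc (lt_gtF bc).
- by rewrite cb.
- by rewrite (lt_trans cb ba).
- by rewrite cb.
- by rewrite ab (lt_gtF ab) ltxx.
- by rewrite ba.
- by rewrite ltxx Algebra.addrA.
Qed.

Fact layered_mulA : associative layered_mul.
Proof. by move=> [k a] [l b] [m c]; rewrite /layered_mul /= !mulgA. Qed.

Fact layered_mul1l : left_id layered_one layered_mul.
Proof. by case=> k a; rewrite /layered_mul /= !mul1g. Qed.

Fact layered_mul1r : right_id layered_one layered_mul.
Proof. by case=> k a; rewrite /layered_mul /= !mulg1. Qed.

Fact layered_mulC : commutative layered_mul.
Proof.
by move=> [k a] [l b]; rewrite /layered_mul /= (zfmulC k) (zfmulC a).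
Qed.

Fact value_ltM (c a b : G) : (a * c < b * c)%O = (a < b)%O.
Proof.
have leM u v : (u <= v)%O -> (u * c <= v * c)%O.
  by rewrite !(zfmulC _ c); apply: zfle_mul2l.
apply/idP/idP => [|/[dup] ltab /ltW leab].
  by apply: contraTT; rewrite -!leNgt; apply: leM.
rewrite lt_neqAle leM // andbT; apply/eqP; rewrite !(zfmulC _ c) => /zfmulI eqab.
by rewrite eqab ltxx in ltab.
Qed.

Fact layered_mulDl : left_distributive layered_mul layered_add.
Proof.
move=> [k a] [l b] [m c]; rewrite /layered_mul /layered_add /= !value_ltM.
by case: (ltgtP a b) => //= _; rewrite zfmulDl.
Qed.

HB.instance Definition _ :=
  Algebra.isAddSemigroup.Build D layered_addC layered_addA.
HB.instance Definition _ :=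
  isMonoid.Build D layered_mulA layered_mul1l layered_mul1r.
HB.instance Definition _ := isComZfSemiring.Build D layered_mulC layered_mulDl.

End LayeredDomain.

(* Polynomials in one variable over a zero-free semiring: nonempty finite formal
   sums of monomials with distinct exponents. [zfp_low] lists the coefficients of
   x^0, ..., x^(n-1), where [None] means that the monomial is absent, and
   [zfp_lead] is the coefficient of the leading monomial x^n, n = size zfp_low. *)
Record zfpoly (R : Type) := ZfPoly { zfp_low : seq (option R); zfp_lead : R }.

Definition zfpoly_over (R : Type) (H : set R) (f : zfpoly R) : Prop :=
  H (zfp_lead f) /\
  forall i h, nth None (zfp_low f) i = Some h -> H h.

(* The sum of the terms h_j a^(i + j) for h_j the coefficients in [cs], plus
   h a^(i + size cs). *)
Fixpoint eval_from (R : comZfSemiringType) (h a : R) (cs : seq (option R))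
    (i : nat) : R :=
  match cs with
  | [::] => h * a ^+ i
  | None :: cs' => eval_from h a cs' i.+1
  | Some c :: cs' => c * a ^+ i + eval_from h a cs' i.+1
  end.

Definition zfeval (R : comZfSemiringType) (f : zfpoly R) (a : R) : R :=
  eval_from (zfp_lead f) a (zfp_low f) 0.

Definition adjoin (R : comZfSemiringType) (H : set R) (a : R) : set R :=
  [set y | exists2 f : zfpoly R, zfpoly_over H f & y = zfeval f a].

Definition subsemiring (R : comZfSemiringType) (S : set R) : Prop :=
  [/\ S 1,
      (forall x y, S x -> S y -> S (x + y)%R)
    & (forall x y, S x -> S y -> S (x * y))].

(* Without zero, every element of a semifield is invertible. *)
Definition subsemifield (R : comZfSemiringType) (S : set R) : Prop :=
  subsemiring S /\ forall x, S x -> exists2 y, S y & x * y = 1.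

Section LayeredSets.
Context {dL dG : Order.disp_t} {L : sortingSemiringType dL}
        {G : valueSemiringType dG}.
Implicit Types (E U H : set (layered L G)).

Definition layered_set (L' : set L) (G' : set G) : set (layered L G) :=
  [set x | L' (sorting x) /\ G' (nu x)].

(* Uniform layered domains contained in D. The orders, both cancellation
   properties and "addition is max" are inherited by subsemirings. *)
Definition uniform_subdomain E : Prop :=
  exists (L' : set L) (G' : set G),
    [/\ subsemiring L', subsemiring G' & E = layered_set L' G'].

Definition uniform_subsemifield H : Prop :=
  uniform_subdomain H /\ subsemifield H.

(* [is_uniform_closure E U]: the uniform closure of E in D exists and is U. *)
Definition is_uniform_closure E U : Prop :=
  [/\ uniform_subdomain U, E `<=` U
    & forall V, uniform_subdomain V -> E `<=` V -> U `<=` V].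

Definition sorts E : set L := [set sorting x | x in E].
Definition values E : set G := [set nu x | x in E].

End LayeredSets.

(* Main.v *)
Require Import Defs.
From HB Require Import structures.
From mathcomp Require Import all_boot all_order.
From mathcomp Require Import classical_sets.

(** Write H = L' ⊙ G'.  The value map of D turns addition into maximum, so the
    value of f(a) is the largest value among the terms of f at a; in particular
    it is the value g * nu(a)^i of a single monomial, with g in G'.  As G is
    totally ordered, the set M of these monomial values is closed under maximum;
    it is closed under products, and is therefore a semiring of values.

    The crux ([adjoin_monomials]) is that H[a] is all of L' ⊙ M.  Given l in L'
    and g * nu(a)^i in M, the element l ⊙ (g * nu(a)^i) is the value at a of the
    one-term polynomial ((l * s(a)^-i) ⊙ g) x^i, whose coefficient lies in H:
    this is where H is a semifield and s(a) is a sort of H.  The set M involves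
    a only through nu(a), so the same description applies to H[nu(a)] and shows
    M = G(H[nu(a)]).  Finally L' ⊙ M is itself a uniform domain, hence is its own
    uniform closure. *)

Set Implicit Arguments.
Unset Strict Implicit.
Unset Printing Implicit Defensive.

Import Order.TTheory.
Local Open Scope classical_set_scope.
Local Open Scope ring_scope.
Local Open Scope group_scope.

(** * Polynomial values over a zero-free semiring *)

Section ZeroFree.
Variable R : comZfSemiringType.
Implicit Types (S H : set R) (a b x y : R).

Definition monomials H b : set R :=
  [set y | exists2 h, H h & exists i, y = h * b ^+ i].

Lemma subsemiringX S x i : subsemiring S -> S x -> S (x ^+ i).
Proof.
by case=> S1 _ SM Sx; elim: i => // i IHi; rewrite expgS; apply: SM.
Qed.

Lemma zfmul_inv_exp a b i : a * b = 1 -> a ^+ i * b ^+ i = 1.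
Proof. by move=> ab1; rewrite -expgMn ?ab1 ?expg1n //; apply: zfmulC. Qed.

Lemma monomials_sub_adjoin H a : monomials H a `<=` adjoin H a.
Proof.
move=> _ [h Hh [i ->]]; exists (ZfPoly (nseq i None) h).
  by split=> //= j c; rewrite nth_nseq if_same.
have eval_absent k : eval_from h a (nseq i None) k = h * a ^+ (i + k).
  by elim: i k => //= i IHi k; rewrite IHi addnS.
by rewrite /zfeval /= eval_absent addn0.
Qed.

Lemma adjoin_sub H S a :
    monomials H a `<=` S -> (forall x y, S x -> S y -> S (x + y)%R) ->
  adjoin H a `<=` S.
Proof.
move=> monS addS _ [[cs h] [/= Hh Hcs] ->]; rewrite /zfeval /=.
elim: cs 0%N Hcs => [|[c|] cs IHcs] i Hcs /=.
- by apply: monS; exists h => //; exists i.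
- apply: addS; last by apply: IHcs => j d; apply: (Hcs j.+1).
  by apply: monS; exists c; [apply: (Hcs 0%N)|exists i].
- by apply: IHcs => j d; apply: (Hcs j.+1).
Qed.

End ZeroFree.

(** Closure under addition is where total ordering enters: a maximum of two
    monomials is one of them. *)
Lemma subsemiring_monomials (d : Order.disp_t) (G : valueSemiringType d)
    (G' : set G) (b : G) :
  subsemiring G' -> subsemiring (monomials G' b).
Proof.
case=> G1 _ GM; split=> [|x y Mx My|_ _ [g Gg [i ->]] [h Gh [j ->]]].
- by exists 1 => //; exists 0%N; rewrite mulg1.
- by rewrite zfaddE; case: leP.
- exists (g * h); first exact: GM.
  by exists (i + j)%N; rewrite expgnDr !mulgA -(mulgA g) (zfmulC (b ^+ i)) mulgA.
Qed.

(** * Sorts and values in layered domains *)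

Section Layered.
Context {dL dG : Order.disp_t}.
Variables (L : sortingSemiringType dL) (G : valueSemiringType dG).
Local Notation D := (layered L G).
Implicit Types (x y a : D) (H : set D).

Lemma nuD x y : nu (x + y)%R = (nu x + nu y)%R.
Proof.
rewrite zfaddE; change (nu (layered_add x y) = Order.max (nu x) (nu y)).
by rewrite /layered_add; case: ltgtP => //= ->.
Qed.

Lemma nuX x i : nu (x ^+ i) = nu x ^+ i.
Proof. by elim: i => // i IHi; rewrite !expgS -IHi. Qed.

Lemma sortingX x i : sorting (x ^+ i) = sorting x ^+ i.
Proof. by elim: i => // i IHi; rewrite !expgS -IHi. Qed.

Lemma layered_setD (L' : set L) (G' : set G) x y :
    subsemiring L' -> subsemiring G' ->
  layered_set L' G' x -> layered_set L' G' y -> layered_set L' G' (x + y)%R.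
Proof.
move=> [_ LD _] [_ GD _] [Lx Gx] [Ly Gy]; split; last by rewrite nuD; apply: GD.
change (L' (sorting (layered_add x y))); rewrite /layered_add.
by case: ltgtP => //= _; apply: LD.
Qed.

Lemma sorts_layered_set (L' : set L) (G' : set G) :
  G' !=set0 -> sorts (layered_set L' G') = L'.
Proof.
move=> [g Gg]; apply/seteqP; split=> [_ [x [Lx _] <-] //|l Ll].
by exists (l ⊙ g).
Qed.

Lemma values_layered_set (L' : set L) (G' : set G) :
  L' !=set0 -> values (layered_set L' G') = G'.
Proof.
move=> [l Ll]; apply/seteqP; split=> [_ [x [_ Gx] <-] //|g Gg].
by exists (l ⊙ g).
Qed.

(** The sort map is multiplicative, so the sort of the inverse of l ⊙ 1 is an
    inverse of l. *)
Lemma sorts_inverse (L' : set L) (G' : set G) l :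
    subsemiring G' -> subsemifield (layered_set L' G') -> L' l ->
  exists2 m, L' m & m * l = 1.
Proof.
move=> [G1 _ _] [_ invH] Ll.
have [//|y [Ly _] ly1] := invH (l ⊙ 1).
by exists (sorting y) => //; rewrite zfmulC; apply: (congr1 (@sorting L G) ly1).
Qed.

(** Sorts and values of monomials are independent: multiplying by a power of a
    multiplies the sort by an invertible element of L', which the coefficient
    can compensate without changing the value. *)
Lemma adjoin_monomials (L' : set L) (G' : set G) a :
    subsemiring L' -> subsemiring G' ->
    subsemifield (layered_set L' G') -> L' (sorting a) ->
  adjoin (layered_set L' G') a = layered_set L' (monomials G' (nu a)).
Proof.
move=> semiL semiG fieldH La; apply/seteqP; split.
  apply: adjoin_sub => [_ [h [Lh Gh] [i ->]]|x y]; last first.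
    by apply: layered_setD => //; apply: subsemiring_monomials.
  split=> /=; last by exists (nu h) => //; exists i; rewrite -nuX.
  by have [_ _ LM] := semiL; rewrite sortingX; apply: LM => //; apply: subsemiringX.
move=> [l _] [/= Ll [g Gg [i ->]]]; apply: monomials_sub_adjoin.
have [m Lm ma1] := sorts_inverse semiG fieldH La.
exists ((l * m ^+ i) ⊙ g).
  by split=> //=; have [_ _ LM] := semiL; apply: LM => //; apply: subsemiringX.
exists i; change (l ⊙ (g * nu a ^+ i) =
  (l * m ^+ i * sorting (a ^+ i)) ⊙ (g * nu (a ^+ i))).
by rewrite sortingX nuX -mulgA zfmul_inv_exp // mulg1.
Qed.

Lemma is_uniform_closure_refl H : uniform_subdomain H -> is_uniform_closure H H.
Proof. by split. Qed.

End Layered.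

Theorem proposition5p16 (dL dG : Order.disp_t)
    (L : sortingSemiringType dL) (G : valueSemiringType dG)
    (H : set (layered L G)) (a : layered L G)
    (H_semifield : uniform_subsemifield H)
    (sort_a : sorts H (sorting a)) :
  is_uniform_closure (adjoin H a) (adjoin H a) /\
  adjoin H a = layered_set (sorts H) (values (adjoin H (Layered 1%g (nu a)))).
Proof.
case: H_semifield sort_a => -[L' [G' [semiL semiG ->]]] fieldH.
have [[L1 _ _] [G1 _ _]] := (semiL, semiG).
rewrite sorts_layered_set; last by exists 1.
move=> La; rewrite !adjoin_monomials //=.
rewrite values_layered_set; last by exists 1.
split=> //; apply: is_uniform_closure_refl.
by exists L', (monomials G' (nu a)); split=> //; apply: subsemiring_monomials.
Qed.
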